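(* Let $w(y)=\left(1+\sqrt{1-y}\right)^{-\frac12}$, $0<y<1$. The power series distribution of the function $w$, with parameterization by the mean $x$, is $$\Pr(\xi=k)=p(k,x)=\binom{4k+1}{2k}\,2^{-k}\,x^{k}\,(2k+1)^{k+\frac12}\,(4k+1)^{-2k-\frac32},\qquad x>0,\quad k=0,1,2,\ldots$$
   Context: Let $w(y)=\sum_{k=0}^{\infty}a_k y^k$, $0<y<R$, where all coefficients $a_k$ are non-negative. The power series distribution of the function $w$ with parameter $y$ is the distribution of the integer random variable $\xi$ given by $\Pr(\xi=k)=p_k(y)=\dfrac{a_k y^k}{w(y)}$, $k=0,1,2,\ldots$. Its expected value is $E\xi=\dfrac{y\,w'(y)}{w(y)}$. Denote $E\xi$ by $x$. The function $x=\dfrac{y\,w'(y)}{w(y)}$ on $(0,R)$ has an inverse $y=y(x)$, and the distribution can be characterized by the parameter $x$ instead of $y$: $\Pr(\xi=k)=p(k,x)=p_k(y(x))=\dfrac{a_k\,(y(x))^k}{w(y(x))}$, $k=0,1,2,\ldots$. This is called parameterization by the mean. For $w(y)=\left(1+\sqrt{1-y}\right)^{-\frac12}$ one has $x=\dfrac{1-\sqrt{1-y}}{4\sqrt{1-y}}$ and $y(x)=\dfrac{8x(2x+1)}{(4x+1)^2}$, $x>0$.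
   Formalization: The printed formula is false (at k=0 it gives 1 for all x>0, but a_0/w(y(x)) = sqrt((2x+1)/(4x+1))); the factors (2k+1)^{k+1/2}(4k+1)^{-2k-3/2} are corrected to (2x+1)^{k+1/2}(4x+1)^{-2k-1/2}(4k+1)^{-1}. *)

(* Defs.v *)
From Stdlib Require Import Reals.
From Coquelicot Require Import Coquelicot.
Open Scope R_scope.

(* Distributions of random variables with values in {0, 1, 2, ...} are
   represented by their mass functions k |-> Pr(xi = k). *)
Definition is_distribution (p : nat -> R) : Prop :=
  (forall k, 0 <= p k) /\ is_series p 1.

Definition has_expectation (p : nat -> R) (m : R) : Prop :=
  is_series (fun k => INR k * p k) m.

Definition nonneg_power_series (w : R -> R) (rho : R) (a : nat -> R) : Prop :=
  (forall k, 0 <= a k) /\ (forall y, 0 < y < rho -> is_pseries a y (w y)).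

Definition power_series_distribution
    (w : R -> R) (a : nat -> R) (y : R) (k : nat) : R :=
  a k * y ^ k / w y.

Definition mean_function (w : R -> R) (y : R) : R := y * Derive w y / w y.

(* f maps D bijectively onto E, and g is its inverse there; values of f off D
   and of g off E are irrelevant. *)
Definition inverse_between (D E : R -> Prop) (f g : R -> R) : Prop :=
  (forall y, D y -> E (f y) /\ g (f y) = y) /\
  (forall x, E x -> D (g x) /\ f (g x) = x).

(* The law p(., x), where yx is the inverse of the mean function. *)
Definition mean_parameterized_distribution
    (w : R -> R) (a : nat -> R) (yx : R -> R) (x : R) (k : nat) : R :=
  power_series_distribution w a (yx x) k.

Definition w_sqrt (y : R) : R := Rpower (1 + sqrt (1 - y)) (- (1 / 2)).

(* Main.v *)
Require Import Defs.
From Stdlib Require Import Reals Lra Lia.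
From Coquelicot Require Import Coquelicot.
Open Scope R_scope.

(** With [s = sqrt (1 - y)] and [t = sqrt y] one has
    [(sqrt (1 + t) - sqrt (1 - t))^2 = 2 (1 - s)] and [(1 - s) (1 + s) = y], so
    [w y = (sqrt (1 + t) - sqrt (1 - t)) / (sqrt 2 * t)].  The coefficients of
    [w] are thus, up to the factor [sqrt 2], the odd coefficients of the
    binomial series of [sqrt (1 + t)], and a power series is determined by its
    values to the right of [0].  The mean is [(1 - s) / (4 s)], and solving
    for [s] gives [s = 1 / (4 x + 1)]. *)

(** * Series and power series *)

Lemma is_series_ext_R (u v : nat -> R) (l : R) :
  (forall n, u n = v n) -> is_series u l -> is_series v l.
Proof. exact (is_series_ext u v l). Qed.

Lemma is_series_Rmult_l (c : R) (u : nat -> R) (l : R) :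
  is_series u l -> is_series (fun n => c * u n) (c * l).
Proof. exact (is_series_scal_l (K := R_AbsRing) c u l). Qed.

(** Terms of a convergent series tend to 0, which fails at every point outside the disk of
    convergence. *)
Lemma CV_radius_ge_of_ex_pseries (a : nat -> R) (r : R) :
  ex_pseries a r -> Rbar_le (Rabs r) (CV_radius a).
Proof.
  intros H.
  apply Rbar_not_lt_le; intros Hlt.
  apply (CV_disk_outside _ _ Hlt).
  apply ex_series_lim_0, ex_pseries_R, H.
Qed.

Lemma CV_radius_gt_of_ex_pseries (a : nat -> R) (rho y : R) :
  (forall r, 0 < r < rho -> ex_pseries a r) -> 0 < y < rho ->
  Rbar_lt (Rabs y) (CV_radius a).
Proof.
  intros H Hy.
  (* The midpoint of [y] and [rho] is a point of convergence strictly beyond [y], which makes the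
     bound strict. *)
  apply Rbar_lt_le_trans with (Rabs ((y + rho) / 2)).
  - simpl. rewrite !Rabs_pos_eq; lra.
  - apply CV_radius_ge_of_ex_pseries, H; lra.
Qed.

(** By continuity at 0 the constant term is the limit of the sum from the right, hence 0. Dividing
    the sum by [y] shifts the coefficients, and induction reaches all the others. *)
Lemma PSeries_zero_right (d : nat -> R) (rho : R) :
  0 < rho ->
  (forall y, 0 < y < rho -> ex_pseries d y /\ PSeries d y = 0) ->
  forall n, d n = 0.
Proof.
  intros Hrho H n; revert d H.
  assert (H0 : forall d : nat -> R,
    (forall y, 0 < y < rho -> ex_pseries d y /\ PSeries d y = 0) -> d 0%nat = 0).
  { intros d H.
    assert (Hr : Rbar_lt (Rabs 0) (CV_radius d)).
    { apply Rbar_lt_trans with (Rabs (rho / 2)).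
      - simpl. rewrite Rabs_R0, Rabs_pos_eq; lra.
      - apply CV_radius_gt_of_ex_pseries with rho; [apply H | lra]. }
    rewrite <- (PSeries_0 d).
    destruct (Req_dec (PSeries d 0) 0) as [E | E]; [exact E | exfalso].
    destruct (PSeries_continuity d 0 Hr (Rabs (PSeries d 0))) as [e [He Hc]].
    { apply Rabs_pos_lt, E. }
    (* At [z] the sum is 0 by hypothesis, yet continuity puts it at a distance less than
       [Rabs (PSeries d 0)] from [PSeries d 0]. *)
    pose (z := Rmin (e / 2) (rho / 2)).
    assert (Hz : 0 < z < rho /\ z < e).
    { unfold z, Rmin; destruct Rle_dec; lra. }
    specialize (Hc z).
    simpl in Hc; unfold Rdist in Hc.
    rewrite (proj2 (H z (proj1 Hz))), Rminus_0_l, Rabs_Ropp in Hc.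
    apply (Rlt_irrefl (Rabs (PSeries d 0))), Hc.
    split; [split; [exact I | lra] | rewrite Rminus_0_r, Rabs_pos_eq; lra]. }
  induction n as [| n IH]; intros d H; [apply H0, H |].
  apply (IH (PS_decr_1 d)).
  intros y Hy; destruct (H y Hy) as [Hex Hs].
  split.
  - apply CV_radius_inside.
    rewrite CV_radius_decr_1.
    apply CV_radius_gt_of_ex_pseries with rho; [apply H | lra].
  - rewrite PSeries_decr_1, (H0 d H) in Hs by exact Hex.
    apply Rmult_eq_reg_l with y; lra.
Qed.

Lemma nonneg_power_series_ex (w : R -> R) (rho : R) (a : nat -> R) :
  nonneg_power_series w rho a -> forall y, 0 < y < rho -> ex_pseries a y.
Proof. intros [_ H] y Hy; exists (w y); apply H, Hy. Qed.

Lemma nonneg_power_series_unique (w : R -> R) (rho : R) (a b : nat -> R) :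
  0 < rho ->
  nonneg_power_series w rho a -> nonneg_power_series w rho b ->
  forall n, a n = b n.
Proof.
  intros Hrho [_ Ha] [_ Hb] n.
  apply Rminus_diag_uniq.
  apply (PSeries_zero_right (PS_minus a b) rho Hrho).
  intros y Hy.
  assert (H : is_pseries (PS_minus a b) y (minus (w y) (w y))).
  { exact (is_pseries_minus a b y _ _ (Ha y Hy) (Hb y Hy)). }
  split; [eexists; exact H |].
  rewrite (is_pseries_unique _ _ _ H).
  unfold minus, plus, opp; simpl; ring.
Qed.

(** * Power series distributions *)

Lemma power_series_distribution_is_distribution
    (w : R -> R) (rho : R) (a : nat -> R) (y : R) :
  nonneg_power_series w rho a -> 0 < y < rho -> 0 < w y ->
  is_distribution (power_series_distribution w a y).
Proof.
  intros [Hpos Hs] Hy Hw; split.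
  - intros k; unfold power_series_distribution.
    apply Rdiv_le_0_compat; [| exact Hw].
    apply Rmult_le_pos; [apply Hpos | apply pow_le; lra].
  - replace 1 with (/ w y * w y) by (field; lra).
    apply is_series_ext_R with (fun k => / w y * (a k * y ^ k)).
    { intros k; unfold power_series_distribution; field; lra. }
    apply (is_series_Rmult_l (/ w y)), is_pseries_R, Hs, Hy.
Qed.

(** Termwise differentiation inside the disk turns the sum of [k * a k * y ^ k] into [y] times the
    derivative of [w]. *)
Lemma power_series_distribution_has_expectation
    (w : R -> R) (rho : R) (a : nat -> R) (y : R) :
  nonneg_power_series w rho a -> 0 < y < rho -> 0 < w y ->
  has_expectation (power_series_distribution w a y) (mean_function w y).
Proof.
  intros Ha Hy Hw.
  assert (Hr : Rbar_lt (Rabs y) (CV_radius a)).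
  { apply CV_radius_gt_of_ex_pseries with rho;
      [eapply nonneg_power_series_ex, Ha | exact Hy]. }
  assert (HD : Derive w y = PSeries (PS_derive a) y).
  { rewrite <- Derive_PSeries by exact Hr.
    apply Derive_ext_loc.
    (* [w] agrees with its series only on [(0, rho)]; this radius keeps the neighbourhood of [y]
       inside that interval. *)
    assert (Hd : 0 < Rmin y (rho - y)) by (unfold Rmin; destruct Rle_dec; lra).
    exists (mkposreal _ Hd).
    intros z Hz.
    symmetry; apply is_pseries_unique, Ha.
    apply Rabs_def2 in Hz; simpl in Hz.
    unfold minus, plus, opp in Hz; simpl in Hz.
    revert Hz; unfold Rmin; destruct Rle_dec; lra. }
  unfold has_expectation, mean_function; rewrite HD.
  replace (y * PSeries (PS_derive a) y / w y)
    with (/ w y * (y * PSeries (PS_derive a) y)) by (field; lra).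
  apply is_series_ext_R with
    (fun k => / w y * (PS_incr_1 (PS_derive a) k * y ^ k)).
  { intros [| k]; unfold power_series_distribution, PS_derive, PS_incr_1.
    - change (@zero R_NormedModule) with 0; simpl; field; lra.
    - field; lra. }
  apply (is_series_Rmult_l (/ w y)), is_pseries_R.
  rewrite <- PSeries_incr_1.
  apply PSeries_correct, CV_radius_inside.
  rewrite CV_radius_incr_1, CV_radius_derive; exact Hr.
Qed.

(** * The binomial series *)

Fixpoint gbinom (alpha : R) (n : nat) : R :=
  match n with
  | O => 1
  | S m => gbinom alpha m * ((alpha - INR m) / INR (S m))
  end.

Lemma gbinom_neq_0 (alpha : R) (n : nat) :
  (forall m, alpha <> INR m) -> gbinom alpha n <> 0.
Proof.
  intros H; induction n as [| n IH]; cbn [gbinom]; [lra |].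
  apply Rmult_integral_contrapositive_currified; [exact IH |].
  apply Rmult_integral_contrapositive_currified.
  - apply Rminus_eq_contra, H.
  - apply Rinv_neq_0_compat, not_0_INR; discriminate.
Qed.

(** Consecutive coefficients have ratio [(alpha - n) / (n + 1) = (alpha + 1) / (n + 1) - 1], which
    tends to -1. Excluding natural [alpha] keeps all coefficients nonzero, as the ratio test
    requires. *)
Lemma CV_radius_gbinom (alpha : R) :
  (forall m, alpha <> INR m) -> CV_radius (gbinom alpha) = 1.
Proof.
  intros H.
  rewrite <- Rinv_1.
  apply CV_radius_finite_DAlembert;
    [intros n; apply gbinom_neq_0, H | lra |].
  apply is_lim_seq_ext with
    (fun n => Rabs ((alpha + 1) * / INR (S n) - 1)).
  { intros n.
    f_equal; cbn [gbinom]; rewrite S_INR.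
    pose proof (pos_INR n); field; split; [lra | apply gbinom_neq_0, H]. }
  replace (Finite 1) with (Rbar_abs (Finite (0 - 1)))
    by (simpl; f_equal; rewrite Rminus_0_l, Rabs_Ropp; apply Rabs_R1).
  apply is_lim_seq_abs.
  apply is_lim_seq_minus'; [| apply is_lim_seq_const].
  replace (Finite 0) with (Rbar_mult (alpha + 1) 0)
    by (simpl; f_equal; ring).
  apply is_lim_seq_scal_l.
  apply (is_lim_seq_incr_1 (fun n => / INR n)).
  replace (Finite 0) with (Rbar_inv p_infty) by reflexivity.
  apply is_lim_seq_inv; [apply is_lim_seq_INR | discriminate].
Qed.

(* The sum [f] satisfies [(1 + t) f' = alpha f], hence [f * (1 + t)^(-alpha)]
   is constant. *)
Lemma binomial_series (alpha t : R) :
  (forall m, alpha <> INR m) -> Rabs t < 1 ->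
  is_pseries (gbinom alpha) t (Rpower (1 + t) alpha).
Proof.
  intros H Ht.
  set (f := PSeries (gbinom alpha)).
  assert (Hr : forall u, Rabs u < 1 -> Rbar_lt (Rabs u) (CV_radius (gbinom alpha))).
  { intros u Hu; rewrite CV_radius_gbinom by exact H; exact Hu. }
  assert (Hode : forall u, Rabs u < 1 ->
    (1 + u) * PSeries (PS_derive (gbinom alpha)) u = alpha * f u).
  { intros u Hu.
    unfold f; rewrite Rmult_plus_distr_r, Rmult_1_l.
    rewrite <- (PSeries_incr_1 _ u), <- (PSeries_scal alpha), <- PSeries_plus.
    (* With [c = gbinom alpha], the coefficients satisfy [(n + 1) * c (n + 1) + n * c n = alpha * c
       n], which is the recursion defining [gbinom]. *)
    - apply PSeries_ext.
      intros [| n]; unfold PS_plus, PS_incr_1, PS_scal, PS_derive;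
        unfold plus, scal; simpl; unfold mult; simpl.
      + change (@zero R_NormedModule) with 0; field.
      + change (match n with O => 1 | S _ => INR n + 1 end) with (INR (S n)).
        rewrite S_INR; pose proof (pos_INR n); field; lra.
    - apply CV_radius_inside; rewrite CV_radius_derive; apply Hr, Hu.
    - apply CV_radius_inside; rewrite CV_radius_incr_1, CV_radius_derive;
        apply Hr, Hu. }
  set (g := fun u => f u * Rpower (1 + u) (- alpha)).
  assert (Hg : forall u, Rabs u < 1 -> is_derive g u zero).
  { intros u Hu.
    pose proof (Rabs_def2 _ _ Hu) as Hu'.
    assert (Hf := is_derive_PSeries _ _ (Hr u Hu)).
    assert (HP : is_derive (fun u => Rpower (1 + u) (- alpha)) u
                   (- alpha * / (1 + u) * Rpower (1 + u) (- alpha))).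
    { unfold Rpower; auto_derive; [lra | field; lra]. }
    replace (@zero R_NormedModule) with
      (plus (mult (PSeries (PS_derive (gbinom alpha)) u) (Rpower (1 + u) (- alpha)))
            (mult (f u) (- alpha * / (1 + u) * Rpower (1 + u) (- alpha)))).
    - apply (is_derive_mult f (fun u => Rpower (1 + u) (- alpha)) u _ _ Hf HP).
      intros; apply Rmult_comm.
    - change (PSeries (PS_derive (gbinom alpha)) u * Rpower (1 + u) (- alpha)
        + f u * (- alpha * / (1 + u) * Rpower (1 + u) (- alpha)) = 0).
      replace (PSeries (PS_derive (gbinom alpha)) u) with (alpha * f u / (1 + u)).
      + field; lra.
      + rewrite <- Hode by exact Hu; field; lra. }
  assert (Hg0 : g 0 = 1).
  { unfold g, f; rewrite PSeries_0, Rplus_0_r.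
    unfold Rpower; rewrite ln_1, Rmult_0_r, exp_0; simpl; ring. }
  pose proof (Rabs_def2 _ _ Ht) as Ht'.
  assert (Hgt : g t = 1).
  { rewrite <- Hg0.
    destruct (Rtotal_order t 0) as [Hl | [-> | Hl]]; [| reflexivity |].
    - apply eq_is_derive; [| exact Hl].
      intros u Hu; apply Hg, Rabs_def1; lra.
    - symmetry; apply eq_is_derive; [| exact Hl].
      intros u Hu; apply Hg, Rabs_def1; lra. }
  replace (Rpower (1 + t) alpha) with (f t).
  - apply PSeries_correct, CV_radius_inside, Hr, Ht.
  - unfold g in Hgt; rewrite Rpower_Ropp in Hgt.
    assert (0 < Rpower (1 + t) alpha) by apply exp_pos.
    apply Rmult_eq_reg_r with (/ Rpower (1 + t) alpha).
    + rewrite Hgt; field; lra.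
    + apply Rinv_neq_0_compat; lra.
Qed.

Lemma half_neq_INR (m : nat) : / 2 <> INR m.
Proof.
  intros E; destruct m as [| m].
  - simpl in E; lra.
  - rewrite S_INR in E; pose proof (pos_INR m); lra.
Qed.

(** The partial sums of the odd terms are the partial sums of [u] at the indices [2 * N + 1], a
    subsequence with the same limit. *)
Lemma is_series_odd_terms (u : nat -> R) (l : R) :
  (forall k, u (2 * k)%nat = 0) -> is_series u l ->
  is_series (fun k => u (2 * k + 1)%nat) l.
Proof.
  intros H0 Hu.
  change (is_lim_seq (sum_n (fun k => u (2 * k + 1)%nat)) l).
  apply is_lim_seq_ext with (fun N => sum_n u (2 * N + 1)).
  { induction n as [| n IH].
    - change (2 * 0 + 1)%nat with 1%nat.
      rewrite sum_Sn, !sum_O.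
      replace (u 0%nat) with 0 by (symmetry; apply (H0 0%nat)).
      apply Rplus_0_l.
    - rewrite sum_Sn, <- IH.
      replace (2 * S n + 1)%nat with (S (S (2 * n + 1))) by lia.
      rewrite !sum_Sn.
      replace (S (2 * n + 1)) with (2 * S n)%nat by lia.
      rewrite H0.
      change (sum_n u (2 * n + 1) + 0 + u (S (2 * S n))
              = sum_n u (2 * n + 1) + u (S (2 * S n))).
      ring. }
  apply (is_lim_seq_subseq (sum_n u)); [| exact Hu].
  apply eventually_subseq; intros n; lia.
Qed.

(** * The function [w] *)

Lemma w_sqrt_odd_part (t : R) :
  0 < t < 1 ->
  w_sqrt (t ^ 2) = (sqrt (1 + t) - sqrt (1 - t)) / (sqrt 2 * t).
Proof.
  intros Ht; unfold w_sqrt.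
  assert (H2 : 0 < sqrt 2) by (apply sqrt_lt_R0; lra).
  set (p := sqrt (1 + t)); set (q := sqrt (1 - t)).
  assert (Hp : p * p = 1 + t) by (apply sqrt_sqrt; lra).
  assert (Hq : q * q = 1 - t) by (apply sqrt_sqrt; lra).
  assert (Hp0 : 0 < p) by (apply sqrt_lt_R0; lra).
  assert (Hq0 : 0 < q) by (apply sqrt_lt_R0; lra).
  replace (1 - t ^ 2) with ((1 + t) * (1 - t)) by ring.
  rewrite sqrt_mult by lra; fold p q.
  (* Since [p * p + q * q = 2], the square of [p + q] is [2 * (1 + p * q)]. Hence
     [w_sqrt (t ^ 2) = sqrt 2 / (p + q)], and [p * p - q * q = 2 * t] moves the root sum into the
     numerator as a difference. *)
  replace (1 + p * q) with (((p + q) / sqrt 2) * ((p + q) / sqrt 2)).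
  2: { replace (((p + q) / sqrt 2) * ((p + q) / sqrt 2))
         with ((p * p + q * q + 2 * (p * q)) / (sqrt 2 * sqrt 2)) by (field; lra).
       rewrite Hp, Hq, sqrt_sqrt by lra; field. }
  assert (Hpq : 0 < (p + q) / sqrt 2) by (apply Rdiv_lt_0_compat; lra).
  replace (- (1 / 2)) with (- (/ 2)) by field.
  rewrite Rpower_Ropp, Rpower_sqrt by nra.
  rewrite sqrt_square by lra.
  rewrite Rinv_div.
  apply Rmult_eq_reg_r with (sqrt 2 * t * (p + q)).
  2: { apply Rgt_not_eq; repeat apply Rmult_lt_0_compat; lra. }
  transitivity ((sqrt 2 * sqrt 2) * t); [field; lra |].
  transitivity (p * p - q * q); [| field; lra].
  rewrite Hp, Hq, sqrt_sqrt by lra; ring.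
Qed.

(** This is [sqrt 2 * gbinom (/ 2) (2 * k + 1)] in closed form. *)
Definition w_sqrt_coeff (k : nat) : R :=
  Binomial.C (4 * k + 1) (2 * k) / (sqrt 2 * 16 ^ k * (4 * INR k + 1)).

(** Two steps of the recursion multiply by [(4 k + 1) (4 k + 3) / (4 (2 k + 2) (2 k + 3))], the two
    negative factors cancelling their signs; the right-hand side has the same ratio. *)
Lemma gbinom_half_odd (k : nat) :
  gbinom (/ 2) (2 * k + 1) =
  Binomial.C (4 * k + 1) (2 * k) / (2 * 16 ^ k * (4 * INR k + 1)).
Proof.
  induction k as [| k IH].
  - simpl; unfold Binomial.C; simpl; field.
  - replace (2 * S k + 1)%nat with (S (S (2 * k + 1))) by lia.
    cbn [gbinom]; rewrite IH; clear IH.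
    unfold Binomial.C.
    replace (4 * S k + 1 - 2 * S k)%nat with (S (S (2 * k + 1))) by lia.
    replace (4 * k + 1 - 2 * k)%nat with (2 * k + 1)%nat by lia.
    replace (4 * S k + 1)%nat with (S (S (S (S (4 * k + 1))))) by lia.
    replace (2 * S k)%nat with (S (S (2 * k))) by lia.
    pose proof (INR_fact_neq_0 (2 * k)).
    pose proof (INR_fact_neq_0 (2 * k + 1)).
    rewrite !fact_simpl, !mult_INR, !S_INR, !plus_INR, !mult_INR.
    cbn [pow].
    pose proof (pow_nonzero 16 k ltac:(lra)).
    pose proof (pos_INR k).
    replace (INR 4) with 4 by (simpl; ring).
    replace (INR 2) with 2 by (simpl; ring).
    replace (INR 1) with 1 by reflexivity.
    field; repeat split; try assumption; lra.
Qed.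

Lemma w_sqrt_coeff_pos (k : nat) : 0 < w_sqrt_coeff k.
Proof.
  pose proof (pos_INR k).
  assert (0 < sqrt 2) by (apply sqrt_lt_R0; lra).
  assert (0 < 16 ^ k) by (apply pow_lt; lra).
  apply Rdiv_lt_0_compat.
  - apply Rdiv_lt_0_compat; [| apply Rmult_lt_0_compat]; apply INR_fact_lt_0.
  - repeat apply Rmult_lt_0_compat; lra.
Qed.

Lemma w_sqrt_power_series : nonneg_power_series w_sqrt 1 w_sqrt_coeff.
Proof.
  split; [intros k; apply Rlt_le, w_sqrt_coeff_pos |].
  intros y Hy.
  set (t := sqrt y).
  assert (Hty : t ^ 2 = y) by (apply pow2_sqrt; lra).
  assert (Ht : 0 < t < 1).
  { split; [apply sqrt_lt_R0; lra |].
    rewrite <- sqrt_1; apply sqrt_lt_1; lra. }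
  assert (H2 : 0 < sqrt 2) by (apply sqrt_lt_R0; lra).
  rewrite <- Hty, w_sqrt_odd_part by exact Ht.
  assert (Hs : forall u, Rabs u < 1 ->
    is_series (fun n => gbinom (/ 2) n * u ^ n) (sqrt (1 + u))).
  { intros u Hu.
    pose proof (Rabs_def2 _ _ Hu).
    rewrite <- Rpower_sqrt by lra.
    apply is_pseries_R, binomial_series; [exact half_neq_INR | exact Hu]. }
  assert (Hp := Hs t ltac:(apply Rabs_def1; lra)).
  assert (Hm := Hs (- t) ltac:(apply Rabs_def1; lra)).
  (* Subtracting the series at [- t] kills the even terms and doubles the odd ones; dividing by
     [sqrt 2 * t] then turns [t ^ (2 * k + 1)] into a multiple of [y ^ k]. *)
  assert (Hd := is_series_minus _ _ _ _ Hp Hm); clear Hs Hp Hm.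
  apply is_series_odd_terms in Hd.
  2: { intros k.
       change (gbinom (/ 2) (2 * k) * t ^ (2 * k)
         - gbinom (/ 2) (2 * k) * (- t) ^ (2 * k) = 0).
       rewrite !pow_mult.
       replace ((- t) ^ 2) with (t ^ 2) by ring; ring. }
  apply is_pseries_R.
  replace ((sqrt (1 + t) - sqrt (1 - t)) / (sqrt 2 * t)) with
    (/ (sqrt 2 * t) * (sqrt (1 + t) - sqrt (1 - t))) by (field; lra).
  eapply is_series_ext_R.
  2: { apply (is_series_Rmult_l (/ (sqrt 2 * t))), Hd. }
  intros k.
  change (/ (sqrt 2 * t) *
    (gbinom (/ 2) (2 * k + 1) * t ^ (2 * k + 1)
     - gbinom (/ 2) (2 * k + 1) * (- t) ^ (2 * k + 1))
    = w_sqrt_coeff k * (t ^ 2) ^ k).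
  unfold w_sqrt_coeff.
  rewrite gbinom_half_odd, !pow_add, !pow_mult, !pow_1.
  replace ((- t) ^ 2) with (t ^ 2) by ring.
  pose proof (pos_INR k).
  pose proof (pow_nonzero 16 k ltac:(lra)).
  field; repeat split; try assumption; lra.
Qed.

Lemma w_sqrt_pos (y : R) : 0 < w_sqrt y.
Proof. apply exp_pos. Qed.

(** * The mean and its inverse *)

Lemma mean_function_w_sqrt (y : R) :
  0 < y < 1 ->
  mean_function w_sqrt y = (1 - sqrt (1 - y)) / (4 * sqrt (1 - y)).
Proof.
  intros Hy.
  assert (Hs0 : 0 < sqrt (1 - y)) by (apply sqrt_lt_R0; lra).
  assert (Hss : sqrt (1 - y) * sqrt (1 - y) = 1 - y) by (apply sqrt_sqrt; lra).
  (* With [s = sqrt (1 - y)], the logarithmic derivative is [- / 2 * s' / (1 + s)] where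
     [s' = - / (2 * s)]. The factor [1 + s] later cancels against [y = (1 - s) * (1 + s)]. *)
  assert (HD : is_derive w_sqrt y
     (w_sqrt y * (/ 4 * / ((1 + sqrt (1 - y)) * sqrt (1 - y))))).
  { unfold w_sqrt, Rpower; auto_derive.
    - change (1 + - y) with (1 - y); split; [lra | split; [lra | exact I]].
    - change (1 + - y) with (1 - y); field; lra. }
  unfold mean_function; rewrite (is_derive_unique _ _ _ HD).
  pose proof (w_sqrt_pos y).
  replace y with ((1 - sqrt (1 - y)) * (1 + sqrt (1 - y))) at 1
    by (transitivity (1 - sqrt (1 - y) * sqrt (1 - y)); [ring | lra]).
  field; lra.
Qed.

(** This is [1 - s ^ 2] at [s = / (4 * x + 1)]. *)
Definition y_of_mean (x : R) : R := 8 * x * (2 * x + 1) / (4 * x + 1) ^ 2.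

Lemma sqrt_1_minus_y_of_mean (x : R) :
  0 < x -> sqrt (1 - y_of_mean x) = / (4 * x + 1).
Proof.
  intros Hx.
  replace (1 - y_of_mean x) with (/ (4 * x + 1) * / (4 * x + 1))
    by (unfold y_of_mean; field; lra).
  apply sqrt_square, Rlt_le, Rinv_0_lt_compat; lra.
Qed.

Lemma inverse_y_of_mean :
  inverse_between (fun y => 0 < y < 1) (fun x => 0 < x)
    (mean_function w_sqrt) y_of_mean.
Proof.
  split.
  - intros y Hy; rewrite mean_function_w_sqrt by exact Hy.
    set (s := sqrt (1 - y)).
    assert (Hs0 : 0 < s) by (apply sqrt_lt_R0; lra).
    assert (Hss : s * s = 1 - y) by (apply sqrt_sqrt; lra).
    split.
    + apply Rdiv_lt_0_compat; nra.
    + replace y with (1 - s * s) by lra.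
      unfold y_of_mean; field; split; [| lra].
      replace (1 - s + s) with 1 by ring; lra.
  - intros x Hx.
    assert (H : 0 < y_of_mean x < 1).
    { unfold y_of_mean; split.
      - apply Rdiv_lt_0_compat; [nra | apply pow_lt; lra].
      - apply Rlt_div_l; [apply pow_lt; lra | nra]. }
    split; [exact H |].
    rewrite mean_function_w_sqrt, sqrt_1_minus_y_of_mean by assumption.
    field; lra.
Qed.

(** * The law in terms of the mean *)

Lemma inverse_between_unique (D E : R -> Prop) (f g h : R -> R) :
  inverse_between D E f g -> inverse_between D E f h ->
  forall x, E x -> g x = h x.
Proof.
  intros [_ Hg] [Hh _] x Hx.
  destruct (Hg x Hx) as [HD Hfg].
  rewrite <- (proj2 (Hh _ HD)), Hfg; reflexivity.
Qed.

(** The factor [/ (4 * INR k + 1)] comes from the coefficient, the [k]-dependent powers of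
    [2 * x + 1] and [4 * x + 1] from [y ^ k], and their half-integer parts from [/ w_sqrt y]. The
    two factors [sqrt 2] cancel, and [8 ^ k / 16 ^ k] leaves [/ 2 ^ k]. *)
Lemma w_sqrt_distribution_formula (x : R) (k : nat) :
  0 < x ->
  power_series_distribution w_sqrt w_sqrt_coeff (y_of_mean x) k =
  Binomial.C (4 * k + 1) (2 * k) * / 2 ^ k * x ^ k
  * Rpower (2 * x + 1) (INR k + 1 / 2)
  * Rpower (4 * x + 1) (- 2 * INR k - 1 / 2)
  * / (4 * INR k + 1).
Proof.
  intros Hx.
  assert (H2 : 0 < sqrt 2) by (apply sqrt_lt_R0; lra).
  assert (Hu : 0 < sqrt (2 * x + 1)) by (apply sqrt_lt_R0; lra).
  assert (Hv : 0 < sqrt (4 * x + 1)) by (apply sqrt_lt_R0; lra).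
  assert (Hw : w_sqrt (y_of_mean x)
               = sqrt (4 * x + 1) / (sqrt 2 * sqrt (2 * x + 1))).
  { unfold w_sqrt; rewrite sqrt_1_minus_y_of_mean by exact Hx.
    replace (1 + / (4 * x + 1)) with (2 * (2 * x + 1) / (4 * x + 1))
      by (field; lra).
    replace (- (1 / 2)) with (- (/ 2)) by field.
    rewrite Rpower_Ropp, Rpower_sqrt by (apply Rdiv_lt_0_compat; lra).
    rewrite sqrt_div, sqrt_mult by lra.
    field; lra. }
  assert (E1 : Rpower (2 * x + 1) (INR k + 1 / 2)
               = (2 * x + 1) ^ k * sqrt (2 * x + 1)).
  { replace (1 / 2) with (/ 2) by field.
    rewrite Rpower_plus, Rpower_pow, Rpower_sqrt by lra; reflexivity. }
  assert (E2 : Rpower (4 * x + 1) (- 2 * INR k - 1 / 2)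
               = / ((4 * x + 1) ^ (2 * k) * sqrt (4 * x + 1))).
  { replace (- 2 * INR k - 1 / 2) with (- (INR (2 * k) + / 2))
      by (rewrite mult_INR; simpl INR; field).
    rewrite Rpower_Ropp, Rpower_plus, Rpower_pow, Rpower_sqrt by lra.
    reflexivity. }
  unfold power_series_distribution; rewrite Hw, E1, E2.
  replace (y_of_mean x ^ k)
    with (8 ^ k * x ^ k * (2 * x + 1) ^ k * / (4 * x + 1) ^ (2 * k)).
  2: { unfold y_of_mean, Rdiv.
       rewrite !Rpow_mult_distr, pow_inv, <- pow_mult; reflexivity. }
  unfold w_sqrt_coeff.
  replace (8 ^ k) with (16 ^ k * / 2 ^ k).
  2: { rewrite <- pow_inv, <- Rpow_mult_distr; f_equal; field. }
  pose proof (pow_nonzero 16 k ltac:(lra)).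
  pose proof (pow_nonzero 2 k ltac:(lra)).
  pose proof (pow_nonzero (4 * x + 1) (2 * k) ltac:(lra)).
  pose proof (pos_INR k).
  field; repeat split; try assumption; lra.
Qed.

(* [Binomial.C] is Stdlib's real-valued binomial coefficient ([C] alone is
   Coquelicot's type of complex numbers). *)
Theorem mainTheorem4 :
  (exists a : nat -> R, nonneg_power_series w_sqrt 1 a) /\
  (exists yx : R -> R,
     inverse_between (fun y => 0 < y < 1) (fun x => 0 < x)
       (mean_function w_sqrt) yx) /\
  (forall (a : nat -> R) (yx : R -> R),
     nonneg_power_series w_sqrt 1 a ->
     inverse_between (fun y => 0 < y < 1) (fun x => 0 < x)
       (mean_function w_sqrt) yx ->
     forall x : R, 0 < x ->
       is_distribution (mean_parameterized_distribution w_sqrt a yx x) /\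
       has_expectation (mean_parameterized_distribution w_sqrt a yx x) x /\
       (forall k : nat,
          mean_parameterized_distribution w_sqrt a yx x k =
          Binomial.C (4 * k + 1) (2 * k) * / 2 ^ k * x ^ k
          * Rpower (2 * x + 1) (INR k + 1 / 2)
          * Rpower (4 * x + 1) (- 2 * INR k - 1 / 2)
          * / (4 * INR k + 1))).
Proof.
  split; [exists w_sqrt_coeff; exact w_sqrt_power_series |].
  split; [exists y_of_mean; exact inverse_y_of_mean |].
  intros a yx Ha Hyx x Hx.
  destruct (proj2 Hyx x Hx) as [Hy Hmean].
  split; [| split].
  - apply (power_series_distribution_is_distribution _ _ _ _ Ha Hy), w_sqrt_pos.
  (* Only the claimed expectation is rewritten as the mean at [yx x]; the [x] inside the law
     stays. *)
  - rewrite <- Hmean at 2.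
    apply (power_series_distribution_has_expectation _ _ _ _ Ha Hy), w_sqrt_pos.
  - intros k; rewrite <- w_sqrt_distribution_formula by exact Hx.
    unfold mean_parameterized_distribution, power_series_distribution.
    (* Uniqueness of the inverse and of the coefficients replaces the arbitrary [yx] and [a] by the
       explicit ones. *)
    rewrite (inverse_between_unique _ _ _ _ _ Hyx inverse_y_of_mean x Hx).
    rewrite (nonneg_power_series_unique _ _ _ _ Rlt_0_1 Ha w_sqrt_power_series).
    reflexivity.
Qed.
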